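(* Let $m\ge2$ and $1\le k<m$ be integers, and let $\{a_n\}_{n\ge1}$ be any sequence with $a_n\in\{0,\dots,m-1\}$. Let $F(m,k;\{a_n\})\subset[0,1]$ be the set defined in the context. Then the box-counting dimension of $F(m,k;\{a_n\})$ exists and $$\dim_H F(m,k;\{a_n\})=\dim_B F(m,k;\{a_n\})=\frac{\log k}{\log m}.$$
   Context: Given integers $m\ge 2$, $1\le k<m$ and a sequence $\{a_n\}_{n\ge1}$ in $\{0,\dots,m-1\}$, define compact sets $F_n\subset[0,1]$ recursively. $F_0=[0,1]$, with the single basic interval $[0,1]$ of level $0$. For $n\ge1$, divide each basic interval of level $n-1$ (a closed interval of length $m^{-(n-1)}$) into $m$ congruent closed subintervals of length $m^{-n}$, indexed from left to right by $0,1,\dots,m-1$, and retain only the $k$ subintervals whose indices are congruent modulo $m$ to $$a_n,\; a_n+\lfloor m/k\rfloor,\; a_n+2\lfloor m/k\rfloor,\dots,\; a_n+(k-1)\lfloor m/k\rfloor .$$ The retained subintervals are the basic intervals of level $n$, and $F_n$ is their union. Finally $F(m,k;\{a_n\})=\bigcap_{n=0}^\infty F_n$. $\dim_H$ is the Hausdorff dimension: $\dim_H F$ is the infimum of those $s\ge0$ for which the $s$-dimensional Hausdorff measure of $F$ is zero. For a bounded non-empty $F\subset\mathbb{R}$, $N_\varepsilon(F)$ is the minimal number of closed intervals of length $\varepsilon$ needed to cover $F$; the lower and upper box-counting dimensions are $\liminf_{\varepsilon\to0}\frac{\log N_\varepsilon(F)}{-\log\varepsilon}$ and $\limsup_{\varepsilon\to0}\frac{\log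 N_\varepsilon(F)}{-\log\varepsilon}$, and if they coincide their common value is the box-counting dimension $\dim_B F$. *)

(* Defs.v *)
(* MathComp-Analysis. *)
From mathcomp Require Import all_boot all_order all_algebra.
From mathcomp Require Import all_classical all_reals all_analysis.
Set Implicit Arguments.
Unset Strict Implicit.
Unset Printing Implicit Defensive.
Import Order.TTheory GRing.Theory Num.Theory.
Import numFieldNormedType.Exports.
Local Open Scope classical_set_scope.
Local Open Scope ring_scope.

(* Offsets, inside a basic interval of level n - 1, of the subintervals that
   are retained at level n when a is the n-th term of the sequence. *)
Definition retained (m k a : nat) : set nat :=
  [set i : nat | (i < m)%N /\
     exists2 j : nat, (j < k)%N & i = (a + j * (m %/ k))%N %[mod m]].

(* A basic interval of level n has length m^-n, so it is represented by its
   left endpoint. *)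
Fixpoint basic_endpoint (R : realType) (m k : nat) (a : nat -> nat)
    (n : nat) : set R :=
  if n is p.+1 then
    [set x + i%:R / m%:R ^+ p.+1
       | x in basic_endpoint m k a p & i in retained m k (a p.+1)]
  else [set 0].
Arguments basic_endpoint R m k a n : clear implicits.

Definition level_set (R : realType) (m k : nat) (a : nat -> nat)
    (n : nat) : set R :=
  \bigcup_(x in basic_endpoint R m k a n) `[x, x + m%:R ^- n]%classic.
Arguments level_set R m k a n : clear implicits.

Definition cantor_like_set (R : realType) (m k : nat) (a : nat -> nat)
    : set R :=
  \bigcap_n level_set R m k a n.
Arguments cantor_like_set R m k a : clear implicits.

(* The diameter of set0 is -oo. *)
Definition diam (R : realType) (U : set R) : \bar R :=
  ereal_sup [set `|x - y|%:E | x in U & y in U].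

(* |U|^s, with |set0|^s = 0 and |U|^0 = 1 for every nonempty U. *)
Definition diam_pow (R : realType) (s : R) (U : set R) : \bar R :=
  if U == set0 then 0%E else (diam U `^ s)%E.

(* Finite covers are included, since the U i may be empty. *)
Definition hausdorff_premeasure (R : realType) (s delta : R) (A : set R)
    : \bar R :=
  ereal_inf [set (\sum_(0 <= i <oo) diam_pow s (U i))%E
    | U in [set U : (set R)^nat | A `<=` \bigcup_i U i /\
                        forall i, (diam (U i) <= delta%:E)%E]].

(* The supremum is also the limit as delta decreases to 0. *)
Definition hausdorff_measure (R : realType) (s : R) (A : set R) : \bar R :=
  ereal_sup [set hausdorff_premeasure s delta A
    | delta in [set delta : R | 0 < delta]].

Definition hausdorff_dim (R : realType) (A : set R) : \bar R :=
  ereal_inf [set s%:E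
    | s in [set s : R | 0 <= s /\ hausdorff_measure s A = 0%E]].

Definition covered_by_segments (R : realType) (A : set R) (eps : R) (n : nat) : Prop :=
  exists c : 'I_n -> R, A `<=` \bigcup_i `[c i, c i + eps]%classic.

(* Meaningful for bounded A and eps > 0; 0 if there is no finite cover. *)
Definition covering_number (R : realType) (A : set R) (eps : R) : nat :=
  xget 0%N [set n : nat | covered_by_segments A eps n /\
                    forall p : nat, covered_by_segments A eps p -> (n <= p)%N].

Definition box_quotient (R : realType) (A : set R) (eps : R) : \bar R :=
  (ln (covering_number A eps)%:R / - ln eps)%:E.

Definition lower_box_dim (R : realType) (A : set R) : \bar R :=
  limf_einf (box_quotient A) 0^'+.

Definition upper_box_dim (R : realType) (A : set R) : \bar R :=
  limf_esup (box_quotient A) 0^'+.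

Definition is_box_dim (R : realType) (A : set R) (d : \bar R) : Prop :=
  lower_box_dim A = d /\ upper_box_dim A = d.

(* Main.v *)
Require Import Defs.
From mathcomp Require Import all_boot all_order all_algebra.
From mathcomp Require Import all_classical all_reals all_analysis.
From mathcomp Require Import zify ring lra.
Import Order.TTheory GRing.Theory Num.Theory.
Import numFieldNormedType.Exports.
Local Open Scope classical_set_scope.
Local Open Scope ring_scope.

(** Write [s = ln k / ln m], so that [m ^ s = k], and [F] for the set.

    All dimensions equal [s] as soon as two estimates hold at the exponent [s]
    ([hausdorff_dim_regular], [is_box_dim_regular]): [F] has a cover by at most
    [C eps^-s] segments of each length [eps < 1], and no countable cover of [F]
    by sets of diameter at most 1 has a sum of [s]-th powers of diameters below
    some [c > 0]. The first one bounds covering numbers from above and makes the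
    [t]-measure vanish for [t > s]; the second one keeps the [t]-measure
    positive for [t < s], and, applied to finite covers by segments, bounds
    covering numbers from below.

    The upper estimate is a count. At each step the [k] retained offsets are
    distinct, so the basic intervals of level [n] are numbered from left to
    right by the [p < k ^ n] ([basic_endpointE]); when [m^-(n+1) <= eps < m^-n]
    the [k ^ n.+1] basic intervals of level [n.+1] give the cover
    ([cantor_like_covers]).

    The lower estimate is a mass distribution argument, done on the parameter
    side. Reading the base-[k] expansion of [y] in [0, 1) as the address of a
    point of [F] gives an order-preserving map [coding] from [0, 1) to [F]. Two
    points of [F] closer than [m^-n] lie in basic intervals of level [n] with
    equal or consecutive numbers, so their parameters are within [2 k^-n] of
    each other. Hence [|y - y'| <= 2 k |coding y - coding y'|^s]
    ([coding_inverse_holder]). A cover of [F] by sets [U i] then pulls back to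
    a cover of [0, 1) by sets of length at most [4 k |U i|^s], and countable
    subadditivity of Lebesgue measure gives [1 <= 4 k sum_i |U i|^s]
    ([hausdorff_premeasure_holder]). Pulling back to the line replaces both the
    construction of a measure on [F] and the compactness of [F]. *)

(** * Diameters and Hausdorff premeasures *)

Section Dimensions.
Context {R : realType}.
Implicit Types (A U : set R) (s t c C eps delta : R).

Lemma le_diam U x y : U x -> U y -> (`|x - y|%:E <= diam U)%E.
Proof. by move=> Ux Uy; apply: ereal_sup_ubound; exists x => //; exists y. Qed.

Lemma diam_segment (x : R) eps : 0 <= eps -> diam `[x, x + eps] = eps%:E.
Proof.
move=> eps0; apply/eqP; rewrite eq_le; apply/andP; split.
  apply: ge_ereal_sup => _ [y /= + [z /= + <-]].
  rewrite !in_itv /= => /andP[? ?] /andP[? ?].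
  by rewrite lee_fin ler_norml; apply/andP; split; lra.
have -> : eps%:E = `|x + eps - x|%:E by rewrite addrAC subrr add0r ger0_norm.
by apply: le_diam; rewrite /= in_itv /= !lexx ?lerDl eps0.
Qed.

Lemma diam_pow_ge0 s U : (0 <= diam_pow s U)%E.
Proof. by rewrite /diam_pow; case: ifP => // _; exact: poweR_ge0. Qed.

Lemma diam_pow0 s : diam_pow s (set0 : set R) = 0%E.
Proof. by rewrite /diam_pow eqxx. Qed.

Lemma diam_pow_segment s (x : R) eps : 0 <= eps ->
  diam_pow s `[x, x + eps] = (eps `^ s)%:E.
Proof.
move=> eps0; rewrite /diam_pow ifF; first by rewrite diam_segment.
apply/negbTE/set0P; exists x.
by rewrite /= in_itv /= lexx lerDl.
Qed.

Lemma diam_fin U : U !=set0 -> (diam U <= 1)%E ->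
  exists2 d, 0 <= d <= 1 & diam U = d%:E.
Proof.
move=> [x Ux]; have := @le_diam U x x Ux Ux; rewrite subrr normr0.
by case: (diam U) => // d; rewrite !lee_fin => d0 d1; exists d => //; apply/andP.
Qed.

(** Diameters at most 1 have powers that decrease with the exponent; a singleton
    obeys this because [0 < s], so that its [s]-th power is 0. *)
Lemma diam_pow_anti s t U : 0 <= t -> t < s -> (diam U <= 1)%E ->
  (diam_pow s U <= diam_pow t U)%E.
Proof.
move=> t0 ts dU; rewrite /diam_pow; case: ifPn => // /set0P U0.
have [d /andP[d0 d1] ->] := diam_fin U U0 dU.
rewrite lee_fin; move: d0; rewrite le_eqVlt => /predU1P[<-|d0].
  by rewrite powR0 ?powR_ge0// gt_eqF// (le_lt_trans t0).
by apply: ger_powR; rewrite ?d0// ltW.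
Qed.

Lemma hausdorff_premeasure_ge0 s delta A :
  (0 <= hausdorff_premeasure s delta A)%E.
Proof.
apply: le_ereal_inf_tmp => _ [U _ <-].
by apply: nneseries_ge0 => *; exact: diam_pow_ge0.
Qed.

Lemma hausdorff_premeasure_anti s t A : 0 <= t -> t < s ->
  (hausdorff_premeasure s 1 A <= hausdorff_premeasure t 1 A)%E.
Proof.
move=> t0 ts; apply: le_ereal_inf_tmp => _ [U [AU dU] <-].
apply: ge_ereal_inf; exists (\sum_(0 <= i <oo) diam_pow s (U i))%E.
  by exists U.
apply: lee_nneseries => [*|i _]; first exact: diam_pow_ge0.
exact: diam_pow_anti.
Qed.

(** Finitely many segments become a sequence of sets by padding with [set0],
    which costs nothing even for [s = 0]. *)
Lemma hausdorff_premeasure_segments s eps delta A N :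
  covered_by_segments A eps N -> 0 <= eps <= delta ->
  (hausdorff_premeasure s delta A <= (N%:R * eps `^ s)%:E)%E.
Proof.
move=> [c Ac] /andP[eps0 epsd].
pose U (i : nat) : set R :=
  if insub i is Some j then `[c j, c j + eps]%classic else set0.
apply: ge_ereal_inf; exists (\sum_(0 <= i <oo) diam_pow s (U i))%E.
  exists U => //; split => [x /Ac[j _ cj]|i].
    by exists (j : nat) => //; rewrite /U valK.
  rewrite /U; case: insub => [j|]; first by rewrite diam_segment// lee_fin.
  by apply: ge_ereal_sup => _ [x []].
rewrite (nneseries_split 0 N); last by move=> *; exact: diam_pow_ge0.
rewrite add0n eseries0 ?adde0; last first.
  by move=> i Ni _; rewrite /U insubN ?diam_pow0// -leqNgt.
apply: (@le_trans _ _ (\sum_(0 <= i < N) (eps `^ s)%:E)%E).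
  apply: lee_sum => i _; rewrite /U; case: insub => [j|].
    by rewrite diam_pow_segment.
  by rewrite diam_pow0 lee_fin powR_ge0.
by rewrite sumEFin lee_fin sumr_const_nat subn0 mulr_natl.
Qed.

Lemma covering_numberP A eps N : covered_by_segments A eps N ->
  covered_by_segments A eps (covering_number A eps) /\
  (covering_number A eps <= N)%N.
Proof.
move=> AN; rewrite /covering_number; case: xgetP => [M _ [AM leM]|nM].
  by split => //; exact: leM.
have exN : exists n, `[<covered_by_segments A eps n>] by exists N; apply/asboolP.
have [M /asboolP AM leM] := ex_minnP exN.
by have [] := nM M; split => // p Ap; apply/leM/asboolP.
Qed.

End Dimensions.

(** * Upper and lower limits of convergent functions *)

Lemma limf_esup_cvg {R : realType} {T : choiceType} {X : filteredType T}
    (F : set_system X) {FF : ProperFilter F} (f : X -> R) (l : R) :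
  f @ F --> l -> limf_esup (fun x => (f x)%:E) F = l%:E.
Proof.
move=> /cvgrPdist_le fl; rewrite limf_esupE; apply/eqP; rewrite eq_le.
apply/andP; split.
  apply/lee_addgt0Pr => e e0; apply: ge_ereal_inf.
  eexists; first by exists [set x | `|l - f x| <= e]; [exact: fl|reflexivity].
  apply: ge_ereal_sup => _ [x /= + <-]; rewrite ler_norml => /andP[? ?].
  by rewrite -EFinD lee_fin; lra.
apply: le_ereal_inf_tmp => _ [V FV <-]; apply/lee_addgt0Pr => e e0.
have [x [Vx /=]] := filter_ex (filterI FV (fl e e0)).
rewrite ler_norml => /andP[? ?].
apply: (@le_trans _ _ ((f x)%:E + e%:E)%E); first by rewrite lee_fin; lra.
by apply: leeD => //; apply: ereal_sup_ubound; exists x.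
Qed.

Lemma limf_einf_cvg {R : realType} {T : choiceType} {X : filteredType T}
    (F : set_system X) {FF : ProperFilter F} (f : X -> R) (l : R) :
  f @ F --> l -> limf_einf (fun x => (f x)%:E) F = l%:E.
Proof.
move=> /cvgN fl; rewrite /limf_einf.
by rewrite (limf_esup_cvg F (fun x => - f x) (- l) fl) /= opprK.
Qed.

(** * Dimensions from estimates at the critical exponent *)

Section Regular.
Context {R : realType}.
Context (A : set R) (s c C : R) (s0 : 0 <= s) (c0 : 0 < c).
Context (Acover : forall eps, 0 < eps < 1 ->
  exists2 N : nat, covered_by_segments A eps N & N%:R <= C * eps `^ (- s)).
Context (Amass : (c%:E <= hausdorff_premeasure s 1 A)%E).

(** Segments of length [eps] have [t]-sum at most [C eps^(t - s)], which tends
    to 0 with [eps]. *)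
Lemma hausdorff_measure_above t : s < t -> hausdorff_measure t A = 0%E.
Proof.
move=> st; have pre0 delta : 0 < delta -> hausdorff_premeasure t delta A = 0%E.
  move=> d0; apply/eqP; rewrite eq_le hausdorff_premeasure_ge0 andbT.
  apply/lee_addgt0Pr => e e0; rewrite add0e.
  have : C * eps `^ (t - s) @[eps --> 0^'+] --> 0.
    by rewrite -[X in _ --> X](mulr0 C); apply: cvgMl_tmp; apply: powR_cvg0; rewrite subr_gt0.
  move=> /cvgr_le/(_ e e0) Ce.
  near (0 : R)^'+ => eps.
  have eps0 : 0 < eps by near: eps; exact: nbhs_right_gt.
  have eps1 : eps < 1 by near: eps; exact: nbhs_right_lt.
  have epsd : eps <= delta by near: eps; exact: nbhs_right_le.
  have [|N AN NC] := Acover eps; first by rewrite eps0.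
  have := hausdorff_premeasure_segments t eps delta A N AN.
  rewrite epsd ltW// => /(_ isT) /le_trans; apply; rewrite lee_fin.
  apply: (@le_trans _ _ (C * eps `^ (t - s))); last by near: eps.
  rewrite addrC powRD ?(gt_eqF eps0) ?implybT// mulrA.
  by rewrite ler_wpM2r// powR_ge0.
apply/eqP; rewrite eq_le; apply/andP; split.
  by apply: ge_ereal_sup => _ [delta d0 <-]; rewrite pre0.
by apply: ereal_sup_ubound; exists 1 => //=; exact: pre0.
Unshelve. all: by end_near. Qed.

Lemma hausdorff_measure_below t : 0 <= t -> t < s ->
  (c%:E <= hausdorff_measure t A)%E.
Proof.
move=> t0 ts; apply: (le_trans Amass).
apply: (le_trans (hausdorff_premeasure_anti s t A t0 ts)).
by apply: ereal_sup_ubound; exists 1 => //=.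
Qed.

Lemma hausdorff_dim_regular : hausdorff_dim A = s%:E.
Proof.
apply/eqP; rewrite eq_le; apply/andP; split.
  apply/lee_addgt0Pr => e e0; apply: ereal_inf_lbound; exists (s + e) => //=.
  split; first by rewrite addr_ge0// ltW.
  by apply: hausdorff_measure_above; rewrite ltrDl.
apply: le_ereal_inf_tmp => _ [t [t0 Ht] <-]; rewrite lee_fin leNgt.
apply/negP => /(hausdorff_measure_below t t0); rewrite Ht lee_fin.
by rewrite leNgt c0.
Qed.

(** A minimal cover by segments is one of the covers over which the premeasure
    takes its infimum, whence the lower bound. *)
Lemma covering_number_bounds eps : 0 < eps < 1 ->
  c * eps `^ (- s) <= (covering_number A eps)%:R <= C * eps `^ (- s).
Proof.
move=> /[dup] /andP[eps0 eps1] /Acover [N AN NC].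
have [Acov covN] := covering_numberP A eps N AN.
rewrite (le_trans _ NC) ?ler_nat// andbT.
have /le_trans := Amass => /(_ _ (hausdorff_premeasure_segments s eps 1 A _ Acov _)).
rewrite (ltW eps0) (ltW eps1) => /(_ isT); rewrite lee_fin powRN.
by rewrite ler_pdivrMr// powR_gt0.
Qed.

(** With [L = - ln eps], the bounds on the covering number put the box quotient
    between [s + ln c / L] and [s + ln C / L]. *)
Lemma is_box_dim_regular : is_box_dim A s%:E.
Proof.
have nl : \forall eps \near (0 : R)^'+, 0 < - ln eps.
  near=> eps; rewrite oppr_gt0 ln_lt0//; apply/andP; split; near: eps.
    exact: nbhs_right_gt.
  exact: nbhs_right_lt.
have ln0 : (- ln eps)^-1 @[eps --> (0 : R)^'+] --> 0.
  apply: (gtr0_cvgV0 nl).2.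
  apply/cvgNrNy; rewrite (_ : - _ = @ln R); first exact: lnNy.
  by apply/funext => x; exact: opprK.
have squeeze d : s + d * (- ln eps)^-1 @[eps --> (0 : R)^'+] --> s.
  rewrite -[X in _ --> X]addr0 -[X in _ + X](mulr0 d).
  by apply: cvgD; [exact: cvg_cst|exact: cvgMl_tmp].
suff q : ln (covering_number A eps)%:R / - ln eps @[eps --> (0 : R)^'+] --> s.
  by split; [exact: limf_einf_cvg q|exact: limf_esup_cvg q].
apply: (squeeze_cvgr _ (squeeze (ln c)) (squeeze (ln C))).
near=> eps.
have eps0 : 0 < eps by near: eps; exact: nbhs_right_gt.
have eps1 : eps < 1 by near: eps; exact: nbhs_right_lt.
have L0 : 0 < - ln eps by near: eps.
have := covering_number_bounds eps; rewrite eps0 eps1 => /(_ isT) /andP[cN NC].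
have p0 : 0 < eps `^ (- s) by rewrite powR_gt0.
have N0 : 0 < (covering_number A eps)%:R :> R by rewrite (lt_le_trans _ cN)// mulr_gt0.
have C0 : 0 < C by rewrite -(pmulr_lgt0 _ p0) (lt_le_trans N0).
have lnE d : 0 < d -> s + ln d / - ln eps = ln (d * eps `^ (- s)) / - ln eps.
  by move=> d0; rewrite lnM// ln_powR; field; lra.
by rewrite !lnE// !ler_pM2r ?invr_gt0// !ler_ln ?posrE ?mulr_gt0// cN NC.
Unshelve. all: by end_near. Qed.

End Regular.

(** Mass distribution principle, with Lebesgue measure on [0, 1) in the role of
    the mass: the part of [0, 1) sent into [U] lies within [K |U|^s] of any one
    of its points, so that [2 K |U|^s] bounds its length. *)
Lemma hausdorff_premeasure_holder {R : realType} (A : set R) (phi : R -> R) (s K : R) :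
  0 < K ->
  (forall y, 0 <= y < 1 -> A (phi y)) ->
  (forall y y', 0 <= y < 1 -> 0 <= y' < 1 ->
     `|y - y'| <= K * `|phi y - phi y'| `^ s) ->
  0 <= s -> ((2 * K)^-1%:E <= hausdorff_premeasure s 1 A)%E.
Proof.
move=> K0 phiA hold s0; apply: le_ereal_inf_tmp => _ [U [AU dU] <-].
have /choice[V VP] i : exists V : set R, [/\ measurable V,
    (lebesgue_measure V <= (2 * K)%:E * diam_pow s (U i))%E &
    forall y, 0 <= y < 1 -> U i (phi y) -> V y].
  have [[y0 [y0_01 Uy0]]|noy] := pselect (exists y, 0 <= y < 1 /\ U i (phi y)); last first.
    exists set0; split => //; last by move=> y y01 Uy; case: noy; exists y.
    by rewrite measure0 mule_ge0 ?diam_pow_ge0// lee_fin mulr_ge0// ltW.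
  have U0 : U i !=set0 by exists (phi y0).
  have [d /andP[d0 d1] dE] := diam_fin (U i) U0 (dU i).
  have -> : diam_pow s (U i) = (d `^ s)%:E.
    by rewrite /diam_pow dE ifF//; apply/negbTE/set0P.
  exists `[y0 - K * d `^ s, y0 + K * d `^ s]%classic; split.
  - exact: measurable_itv.
  - have Kd : 0 <= K * d `^ s by rewrite mulr_ge0 ?powR_ge0// ltW.
    rewrite lebesgue_measure_itv /= lte_fin; case: ifP => _.
      by rewrite -EFinD -EFinM lee_fin; lra.
    by rewrite -EFinM lee_fin -mulrA mulr_ge0.
  - move=> y y01 Uy; rewrite /= in_itv /=.
    have : `|y - y0| <= K * d `^ s.
      apply: (le_trans (hold _ _ y01 y0_01)); rewrite ler_pM2l//.
      rewrite ge0_ler_powR ?nnegrE// -lee_fin -dE; exact: le_diam.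
    by rewrite ler_norml => /andP[? ?]; apply/andP; split; lra.
have cover : `[0, 1[%classic `<=` \bigcup_i V i.
  move=> y /=; rewrite in_itv /= => y01.
  have [i _ Ui] := AU _ (phiA _ y01).
  by exists i => //; have [_ _] := VP i; apply.
have mV i : measurable (V i) by have [] := VP i.
have := measure_sigma_subadditive (@lebesgue_measure R) mV (measurable_itv _) cover.
rewrite /= lebesgue_measure_itv /= lte_fin ltr01 sube0 => le1.
rewrite -(@lee_pmul2l _ (2 * K)%:E) ?lte_fin ?mulr_gt0//.
rewrite -EFinM divff ?gt_eqF ?mulr_gt0// -nneseriesZl; last first.
  by move=> *; exact: diam_pow_ge0.
apply: (le_trans le1); apply: lee_nneseries => [//|i _].
by have [] := VP i.
Qed.


(** * Left-to-right numbering of the basic intervals *)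

Section CantorLike.
Context {R : realType}.
Context (m k : nat) (a : nat -> nat).
Context (hm : (2 <= m)%N) (hk : (1 <= k)%N) (hkm : (k < m)%N).

(** The offsets are sorted because reduction modulo [m] may wrap some of them
    around to the left of the first one. *)
Definition digits (b : nat) : seq nat :=
  sort leq (mkseq (fun j => (b + j * (m %/ k)) %% m)%N k).

Lemma size_digits b : size (digits b) = k.
Proof. by rewrite size_sort size_mkseq. Qed.

(** Two equal offsets would make [m] divide [(j - i) * (m %/ k)], a positive
    number smaller than [k * (m %/ k) <= m]. *)
Lemma digits_sorted b : sorted ltn (digits b).
Proof.
rewrite ltn_sorted_uniq_leq sort_sorted ?andbT; last exact: leq_total.
rewrite sort_uniq; apply/mkseq_uniqP => i j; rewrite !inE.
wlog ij : i j / (i <= j)%N => [H ik jk e|ik jk /eqP].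
  by case: (leqP i j) => [/H|/ltnW/H] ->.
rewrite eq_sym eqn_mod_dvd ?leq_add2l ?leq_mul2r ?ij ?orbT// subnDl -mulnBl => dv.
apply/eqP; rewrite eqn_leq ij leqNgt; apply/negP => ltij.
have q0 : (0 < m %/ k)%N by rewrite divn_gt0// ltnW.
have := dvdn_leq _ dv; rewrite muln_gt0 subn_gt0 ltij q0 => /(_ isT).
apply/negP; rewrite -ltnNge; apply: leq_trans (leq_divM m k).
by rewrite mulnC ltn_pmul2l//; lia.
Qed.

Lemma retainedE b : retained m k b = [set` digits b].
Proof.
apply/seteqP; split => i; rewrite /= mem_sort.
  by move=> [im [j jk]]; rewrite modn_small// => ->; apply/mapP; exists j; rewrite ?mem_iota.
move=> /mapP[j]; rewrite mem_iota => /= jk ->; split; first by rewrite ltn_mod; lia.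
by exists j => //; rewrite modn_mod.
Qed.

Definition digit (b r : nat) : nat := nth 0%N (digits b) r.

Lemma digit_retained b r : (r < k)%N -> retained m k b (digit b r).
Proof. by move=> rk; rewrite retainedE /= mem_nth// size_digits. Qed.

Lemma digit_ltm b r : (r < k)%N -> (digit b r < m)%N.
Proof. by case/(digit_retained b). Qed.

Lemma retained_digit b i : retained m k b i -> exists2 r, (r < k)%N & digit b r = i.
Proof.
rewrite retainedE /= => ib; exists (index i (digits b)); last exact: nth_index.
by rewrite -[X in (_ < X)%N](size_digits b) index_mem.
Qed.

Lemma digit_lt b r r' : (r < r')%N -> (r' < k)%N -> (digit b r < digit b r')%N.
Proof.
move=> rr' r'k; apply: (sorted_ltn_nth ltn_trans _ (digits_sorted b)) => //.
  by rewrite inE size_digits; lia.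
by rewrite inE size_digits.
Qed.

(** The left endpoint of the [p]-th basic interval of level [n], in units of
    [m^-n]: the base-[k] digits of [p] select the retained offsets. At level 0
    the value [p], rather than 0, extends the numbering beyond [k ^ n] so that
    it is strictly increasing on all of [nat]. *)
Fixpoint endpoint_index (n p : nat) : nat :=
  if n is n'.+1 then
    (m * endpoint_index n' (p %/ k) + digit (a n) (p %% k))%N
  else p.

Lemma endpoint_index_lt n : {homo endpoint_index n : p q / (p < q)%N}.
Proof.
elim: n => [//|n IHn] p q pq /=.
have := leq_div2r k (ltnW pq); rewrite leq_eqVlt => /orP[/eqP e|/IHn lt].
  rewrite e ltn_add2l digit_lt ?ltn_mod//.
  by move: pq; rewrite {1}(divn_eq p k) {1}(divn_eq q k) e ltn_add2l.
apply: (@leq_trans (m * (endpoint_index n (p %/ k)).+1)).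
  by rewrite mulnS [X in (_ < X)%N]addnC ltn_add2l digit_ltm// ltn_mod.
by apply: leq_trans (leq_addr _ _); rewrite leq_mul2l lt orbT.
Qed.

Let m0 : 0 < m%:R :> R. Proof. by rewrite ltr0n; lia. Qed.
Let m_neq0 : m%:R != 0 :> R. Proof. by rewrite gt_eqF. Qed.
Let k0 : 0 < k%:R :> R. Proof. by rewrite ltr0n. Qed.
Let mX0 n : 0 < m%:R ^+ n :> R. Proof. by rewrite exprn_gt0. Qed.
Let kX0 n : 0 < k%:R ^+ n :> R. Proof. by rewrite exprn_gt0. Qed.

Definition endpoint (n p : nat) : R := (endpoint_index n p)%:R / m%:R ^+ n.

Lemma endpointS n p : endpoint n.+1 p =
  endpoint n (p %/ k) + (digit (a n.+1) (p %% k))%:R / m%:R ^+ n.+1.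
Proof.
rewrite /endpoint /= natrD natrM exprS; field.
by rewrite m_neq0 expf_neq0.
Qed.

Lemma basic_endpointE n :
  basic_endpoint R m k a n = endpoint n @` `I_(k ^ n).
Proof.
elim: n => [|n IHn] /=.
  apply/seteqP; split => [x /= ->|x /= [[|//] _ <-]].
    by exists 0%N => //; rewrite /endpoint mul0r.
  by rewrite /endpoint mul0r.
rewrite IHn; apply/seteqP; split => x.
  move=> [_ [p /= pk <-] [i /retained_digit[r rk <-] <-]].
  exists (p * k + r)%N => /=.
    apply: (@leq_trans (p.+1 * k)); first by rewrite mulSn addnC ltn_add2r.
    by rewrite expnS mulnC leq_mul2l pk orbT.
  by rewrite endpointS divnMDl// divn_small// addn0 modnMDl modn_small.
move=> [p /= pk <-]; exists (endpoint n (p %/ k)).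
  by exists (p %/ k)%N => //=; rewrite ltn_divLR// mulnC -expnS.
exists (digit (a n.+1) (p %% k)); last by rewrite -endpointS.
by apply: digit_retained; rewrite ltn_mod.
Qed.

(** * Covers by basic intervals *)

Let s : R := ln k%:R / ln m%:R.

Lemma similarity_dim_ge0 : 0 <= s.
Proof. by rewrite divr_ge0// ln_ge0// ler1n//; lia. Qed.

Lemma powR_scale n : (m%:R ^- n) `^ s = k%:R ^- n.
Proof.
have ms : m%:R `^ s = k%:R.
  rewrite /powR (negbTE m_neq0) /s divfK ?lnK//.
  by rewrite gt_eqF// ln_gt0// ltr1n.
by rewrite -powR_invn ?ltW// powRAC ms powR_invn// ltW.
Qed.

Lemma scale_between (d : R) : 0 < d < 1 ->
  exists n, m%:R ^- n.+1 <= d < m%:R ^- n.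
Proof.
move=> /andP[d0 d1].
have ex : exists n, m%:R ^- n.+1 <= d.
  exists (Num.truncn d^-1); rewrite -[leRHS]invrK lef_pV2 ?posrE ?invr_gt0//.
  apply: (le_trans (ltW (truncnS_gt _))); rewrite -natrX ler_nat.
  by apply/ltnW/ltn_expl.
case: (ex_minnP ex) => -[|n] nd nmin; first by exists 0%N; rewrite nd expr0 invr1.
exists n.+1; rewrite nd ltNge; apply/negP => /nmin.
by rewrite ltnn.
Qed.

(** If [m^-(n+1) <= eps < m^-n], enlarging the [k^(n+1)] basic intervals of
    level [n+1] to length [eps] covers the set, and [k^n = (m^-n)^-s] is at most
    [eps^-s]. *)
Lemma cantor_like_covers (eps : R) : 0 < eps < 1 ->
  exists2 N, covered_by_segments (cantor_like_set R m k a) eps N &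
             N%:R <= k%:R * eps `^ (- s).
Proof.
move=> /[dup] /andP[eps0 eps1] /scale_between[n /andP[neps epsn]].
exists (k ^ n.+1)%N.
  exists (fun i => endpoint n.+1 i) => x /(_ n.+1 I).
  rewrite /level_set basic_endpointE => -[_ [p /= pk <-]].
  rewrite in_itv /= => /andP[px xp]; exists (Ordinal pk) => //=.
  by rewrite in_itv /= px (le_trans xp)// lerD2l.
rewrite natrX exprS ler_pM2l// powRN -[leLHS]invrK lef_pV2 ?posrE ?invr_gt0 ?powR_gt0//.
by rewrite -powR_scale ge0_ler_powR ?nnegrE ?similarity_dim_ge0 ?(ltW eps0) ?(ltW epsn)//.
Qed.

(** * Coding of the set by the unit interval *)

(** The first [n] base-[k] digits of [y], read as an integer. *)
Definition floor_index (n : nat) (y : R) : nat := Num.truncn (k%:R ^+ n * y).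

(** The common point of the nested basic intervals with numbers
    [floor_index n y], as the supremum of their left endpoints. *)
Definition coding (y : R) : R :=
  sup (range (fun n => endpoint n (floor_index n y))).

Lemma floor_index_itv n y : 0 <= y ->
  (floor_index n y)%:R / k%:R ^+ n <= y < (floor_index n y).+1%:R / k%:R ^+ n.
Proof.
move=> y0; rewrite ler_pdivrMr// ltr_pdivlMr// [y * _]mulrC.
by apply: truncn_itv; rewrite mulr_ge0// ltW.
Qed.

Lemma floor_index_ltn n y : 0 <= y < 1 -> (floor_index n y < k ^ n)%N.
Proof.
move=> /andP[y0 y1]; rewrite truncn_lt_nat ?mulr_ge0 ?(ltW (kX0 _))//.
by rewrite natrX gtr_pMr.
Qed.

Lemma floor_indexS n y : 0 <= y -> (floor_index n.+1 y %/ k)%N = floor_index n y.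
Proof.
move=> y0; apply/esym/truncn_def.
have /andP[l u] := floor_index_itv n.+1 y y0.
move: l u; set p := floor_index _ _; rewrite ler_pdivrMr// ltr_pdivlMr// => l u.
have {}l : p%:R <= k%:R * (k%:R ^+ n * y) by rewrite mulrA -exprS mulrC.
have {}u : k%:R * (k%:R ^+ n * y) < p.+1%:R by rewrite mulrA -exprS mulrC.
apply/andP; split; rewrite -(ler_pM2l k0) || rewrite -(ltr_pM2l k0).
  by apply: le_trans l; rewrite -natrM ler_nat mulnC leq_divM.
apply: lt_le_trans u _; rewrite -natrM ler_nat mulnC.
by rewrite -ltn_divLR.
Qed.

(** The basic intervals along the expansion of [y] are nested. *)
Lemma endpoint_floor_step n y : 0 <= y ->
  endpoint n (floor_index n y) <= endpoint n.+1 (floor_index n.+1 y) /\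
  endpoint n.+1 (floor_index n.+1 y) + m%:R ^- n.+1 <=
    endpoint n (floor_index n y) + m%:R ^- n.
Proof.
move=> y0; rewrite endpointS floor_indexS//; split.
  by rewrite lerDl divr_ge0// (ltW (mX0 _)).
rewrite -addrA lerD2l -[X in _ + X]mul1r -mulrDl.
have -> : m%:R ^- n = m%:R / m%:R ^+ n.+1 :> R.
  by rewrite exprS; field; rewrite m_neq0 expf_neq0.
by rewrite ler_pM2r ?invr_gt0// natr1 ler_nat digit_ltm// ltn_mod.
Qed.

Lemma coding_itv n y : 0 <= y ->
  endpoint n (floor_index n y) <= coding y <= endpoint n (floor_index n y) + m%:R ^- n.
Proof.
move=> y0; pose x l := endpoint l (floor_index l y).
have incr : nondecreasing_seq x.
  by apply/nondecreasing_seqP => l; have [] := endpoint_floor_step l y y0.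
have decr : nonincreasing_seq (fun l => x l + m%:R ^- l).
  by apply/nonincreasing_seqP => l; have [] := endpoint_floor_step l y y0.
have xub l j : x l <= x j + m%:R ^- j.
  apply: (le_trans (incr _ _ (leq_maxl l j))).
  by apply: le_trans (decr _ _ (leq_maxr l j)); rewrite lerDl invr_ge0 (ltW (mX0 _)).
apply/andP; split.
  apply: ub_le_sup; last by exists n.
  by exists (x 0%N + m%:R ^- 0) => _ [l _ <-]; exact: xub.
apply: ge_sup; first by exists (x 0%N), 0%N.
by move=> _ [l _ <-]; exact: xub.
Qed.

Lemma coding_mem y : 0 <= y < 1 -> cantor_like_set R m k a (coding y).
Proof.
move=> /[dup] /andP[y0 _] y01 n _; rewrite /level_set basic_endpointE.
exists (endpoint n (floor_index n y)); last by rewrite /= in_itv /= coding_itv.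
by exists (floor_index n y) => //=; exact: floor_index_ltn.
Qed.

(** If the numbers at level [n] differed by 2 or more, a whole basic interval's
    length [m^-n] would separate the two points, as [endpoint_index] is strictly
    increasing. *)
Lemma coding_near y y' n : 0 <= y -> y <= y' -> `|coding y - coding y'| < m%:R ^- n ->
  `|y - y'| <= 2 / k%:R ^+ n.
Proof.
move=> y0 yy' d.
have y'0 : 0 <= y' by exact: le_trans yy'.
have /andP[_ cy] := coding_itv n y y0; have /andP[cy' _] := coding_itv n y' y'0.
have pp : (floor_index n y' <= (floor_index n y).+1)%N.
  rewrite leqNgt; apply/negP => /(endpoint_index_lt n) lt2.
  have lt1 := endpoint_index_lt n _ _ (ltnSn (floor_index n y)).
  move: d; apply/negP; rewrite -leNgt distrC; apply: le_trans (ler_norm _).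
  rewrite lerBrDr; apply: le_trans cy'.
  apply: (le_trans (lerD (lexx _) cy)).
  have -> : m%:R ^- n + (endpoint n (floor_index n y) + m%:R ^- n) =
            (endpoint_index n (floor_index n y) + 2)%:R / m%:R ^+ n.
    by rewrite /endpoint natrD; field; rewrite expf_neq0.
  by rewrite ler_pM2r ?invr_gt0// ler_nat; lia.
have /andP[ly _] := floor_index_itv n y y0.
have /andP[_ uy'] := floor_index_itv n y' y'0.
rewrite distrC ger0_norm ?subr_ge0// lerBlDl; apply: (le_trans (ltW uy')).
apply: le_trans (lerD ly (lexx _)); rewrite -mulrDl ler_pM2r ?invr_gt0//.
by rewrite -natrD ler_nat addn2.
Qed.

(** If the images are at distance [d] with [m^-(n+1) <= d < m^-n], the parameters
    are within [2 k^-n] of each other, and [k^-n = k (m^-(n+1))^s <= k d^s]. *)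
Lemma coding_inverse_holder y y' : 0 <= y < 1 -> 0 <= y' < 1 ->
  `|y - y'| <= 2 * k%:R * `|coding y - coding y'| `^ s.
Proof.
wlog yy' : y y' / y <= y'.
  move=> H y01 y'01; have [|/ltW] := leP y y'; first by move=> /H; exact.
  by rewrite distrC (distrC (coding y)) => /H; exact.
move=> /andP[y0 y1] /andP[y'0 y'1]; set d := `|coding y - coding y'|.
have [k1|k1] := leqP k 1.
  (* Here [s = 0], and the right-hand side is 2. *)
  have k1E : k = 1%N by apply/eqP; rewrite eqn_leq k1.
  rewrite /s k1E ln1 mul0r powRr0 !mulr1 distrC ger0_norm ?subr_ge0//; lra.
have s0 : 0 < s by rewrite divr_gt0// ln_gt0// ltr1n.
have := normr_ge0 (coding y - coding y'); rewrite -/d le_eqVlt => /predU1P[d0|d0].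
  (* Equal images are close at every level, so the parameters are equal. *)
  rewrite -d0 powR0 ?gt_eqF// mulr0.
  have : 2 * k%:R^-1 ^+ n @[n --> \oo] --> (0 : R).
    rewrite -[X in _ --> X](mulr0 2); apply: cvgMl_tmp; apply: cvg_expr.
    by rewrite ger0_norm ?invr_ge0 ?(ltW k0)// invf_lt1// ltr1n.
  move=> /cvgr_to_ge; apply; near=> n.
  by rewrite exprVn; apply: coding_near => //; rewrite -/d -d0 invr_gt0.
case: (ltP d 1) => d1; last first.
  apply: (@le_trans _ _ 1).
    by rewrite distrC ger0_norm ?subr_ge0// lerBlDr (le_trans (ltW y'1))// lerDl.
  have : 1 `^ s <= d `^ s by rewrite ge0_ler_powR ?nnegrE ?(ltW s0) ?(ltW d0).
  rewrite powR1 => ds.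
  by rewrite mulr_ege1// mulr_ege1// ler1n.
have [|n /andP[nd dn]] := scale_between d; first by rewrite d0.
apply: (le_trans (coding_near y y' n y0 yy' dn)).
rewrite -mulrA ler_pM2l// -ler_pdivrMl// -invfM -exprS -powR_scale.
by rewrite ge0_ler_powR ?nnegrE ?(ltW s0) ?(ltW d0)// invr_ge0 ltW.
Unshelve. all: by end_near. Qed.

End CantorLike.

Theorem theorem18 (R : realType) (m k : nat) (a : nat -> nat)
    (hm : (2 <= m)%N) (hk : (1 <= k)%N) (hkm : (k < m)%N)
    (ha : forall n : nat, (1 <= n)%N -> (a n < m)%N) :
  hausdorff_dim (cantor_like_set R m k a) = (ln k%:R / ln m%:R)%:E /\
  is_box_dim (cantor_like_set R m k a) (ln k%:R / ln m%:R)%:E.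
Proof.
have s0 := similarity_dim_ge0 (R := R) m k hm hk hkm.
have K0 : 0 < 2 * k%:R :> R by rewrite mulr_gt0// ltr0n.
have mass := hausdorff_premeasure_holder _ _ _ _ K0
  (coding_mem m k a hm hk hkm) (coding_inverse_holder m k a hm hk hkm) s0.
have c0 : 0 < (2 * (2 * k%:R))^-1 :> R by rewrite invr_gt0 mulr_gt0// K0.
have cov := cantor_like_covers (R := R) m k a hm hk hkm.
split.
  exact: (hausdorff_dim_regular _ _ _ _ s0 c0 cov mass).
exact: (is_box_dim_regular _ _ _ _ c0 cov mass).
Qed.
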